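(* Let $k$ be an algebraically closed field and fix an integer $\alpha>0$. Then there are only finitely many quadruples of positive integers $(a,b,c;h)$ with $a\le b\le c$ and $h=a+b+c+\alpha$ for which there exists a normal graded ring $R=k[x,y,z]/(f)$ of type $(a,b,c;h)$.
   Context: The characteristic of $k$ is arbitrary. A normal graded ring $R=k[x,y,z]/(f)$ of type $(a,b,c;h)$ means: $k[x,y,z]$ is graded by $\deg x=a$, $\deg y=b$, $\deg z=c$ (positive integers, $a\le b\le c$), $f$ is a nonzero homogeneous polynomial of degree $h$, and the quotient $R=\bigoplus_{n\ge 0}R_n$ is a $2$-dimensional normal domain. It is always assumed that $R_n\neq 0$ for all $n\gg 0$ (so $\gcd(a,b,c)=1$). The $a$-invariant of $R$ is $a(R)=h-(a+b+c)$, so the condition $h=a+b+c+\alpha$ says $a(R)=\alpha$. *)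

(* Defs.v *)
From HB Require Import structures.
From mathcomp Require Import all_boot all_order all_algebra.
From mathcomp Require Import generic_quotient ring_quotient fraction mxpoly.
From mathcomp Require Import boolp.
From mathcomp Require Import mpoly.

Set Implicit Arguments.
Unset Strict Implicit.
Unset Printing Implicit Defensive.

Import GRing.Theory.

Local Open Scope ring_scope.
Local Open Scope quotient_scope.

(* The library's fraction field is only available for an [idomainType], which  *)
(* carries a (classically unique) inversion function on units. [idomain_of     *)
(* domR] is the ring [R], with that inversion supplied by classical choice.    *)
Definition idomain_of (R : comNzRingType)
  (domR : GRing.integral_domain_axiom R) : Type := R.

Section IdomainOf.
Variables (R : comNzRingType) (domR : GRing.integral_domain_axiom R).
Local Notation D := (idomain_of domR).

HB.instance Definition _ := GRing.ComNzRing.on D.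

Definition idomain_of_unit : {pred D} := fun x => `[< exists y : D, y * x = 1 >].

Definition idomain_of_inv (x : D) : D :=
  if pselect (exists y : D, y * x = 1) is left ex then projT1 (cid ex) else x.

Fact idomain_of_mulVx : {in idomain_of_unit, left_inverse 1 idomain_of_inv *%R}.
Proof.
move=> x /asboolP ux; rewrite /idomain_of_inv; case: pselect => // ex.
exact: projT2 (cid ex).
Qed.

Fact idomain_of_unitPl (x y : D) : y * x = 1 -> idomain_of_unit x.
Proof. by move=> yx1; apply/asboolP; exists y. Qed.

Fact idomain_of_inv_out : {in [predC idomain_of_unit], idomain_of_inv =1 id}.
Proof.
move=> x /asboolP nux; rewrite /idomain_of_inv.
by case: pselect => // /nux.
Qed.

HB.instance Definition _ := GRing.ComNzRing_hasMulInverse.Build D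
  idomain_of_mulVx idomain_of_unitPl idomain_of_inv_out.
HB.instance Definition _ := GRing.ComUnitRing_isIntegral.Build D domR.

End IdomainOf.

Definition integrally_closed (R : idomainType) : Prop :=
  forall x : {fraction R},
    integralOver (@tofrac R) x -> exists r : R, x = tofrac r.

Definition normal_domain (R : comNzRingType) : Prop :=
  exists domR : GRing.integral_domain_axiom R,
    integrally_closed (idomain_of domR).

Definition prime_ideal (R : comNzRingType) (P : {pred R}) : Prop :=
  idealr_closed P /\ prime_idealr_closed P.

(* P 0 < P 1 < ... < P d is a strictly increasing chain of prime ideals. *)
Definition prime_chain (R : comNzRingType) (d : nat) (P : nat -> {pred R}) :
    Prop :=
  (forall i, (i <= d)%N -> prime_ideal (P i)) /\
  (forall i, (i < d)%N ->
     {subset P i <= P i.+1} /\ exists2 x, x \in P i.+1 & x \notin P i).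

Definition krull_dim_eq (R : comNzRingType) (d : nat) : Prop :=
  (exists P : nat -> {pred R}, prime_chain d P) /\
  (forall e (P : nat -> {pred R}), prime_chain e P -> (e <= d)%N).

(* The degree of a monomial when the i-th variable has degree [tnth w i]. *)
Definition mwdeg (n : nat) (w : n.-tuple nat) (m : 'X_{1..n}) : nat :=
  (\sum_(i < n) m i * tnth w i)%N.

Fact mwdeg0 n (w : n.-tuple nat) : mwdeg w 0%MM = 0%N.
Proof. by rewrite /mwdeg big1 // => i _; rewrite mnm0E. Qed.

Fact mwdegD n (w : n.-tuple nat) :
  {morph mwdeg w : m1 m2 / (m1 + m2)%MM >-> (m1 + m2)%N}.
Proof.
move=> m1 m2; rewrite /mwdeg -big_split /=.
by apply: eq_bigr => i _; rewrite mnmDE mulnDl.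
Qed.

HB.instance Definition _ n (w : n.-tuple nat) :=
  isMeasure.Build n (mwdeg w) (mwdeg0 w) (mwdegD w).

(* [normal_graded_ring a b c h f I]: I is the ideal (f), and {ideal_quot I},   *)
(* i.e. k[x,y,z]/(f), is a normal graded ring of type (a,b,c;h). Its component *)
(* of degree n consists of the classes of the homogeneous polynomials of       *)
(* degree n.                                                                   *)
Record normal_graded_ring (k : fieldType) (a b c h : nat)
    (f : {mpoly k[3]}) (I : idealr {mpoly k[3]}) : Prop := {
  ngr_weights : [/\ (0 < a)%N, (a <= b)%N & (b <= c)%N];
  ngr_neq0 : f != 0;
  ngr_homog : f \is h.-homog for (mwdeg [tuple a; b; c]);
  ngr_ideal : forall p, p \in (I : {pred _}) <-> exists q, p = q * f;
  ngr_dim : krull_dim_eq {ideal_quot I} 2;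
  ngr_normal : normal_domain {ideal_quot I};
  ngr_component_neq0 : exists N : nat, forall n : nat, (N <= n)%N ->
    exists2 p : {mpoly k[3]}, p \is n.-homog for (mwdeg [tuple a; b; c])
      & \pi_({ideal_quot I}) p != 0
}.

(* Main.v *)
(* If no monomial of f has degree at most 1 in (u, v) jointly, for two of the
   three variables, then f = u^2 A + u v B + v^2 C. In R = k[x,y,z]/(f) the
   fraction u A / v is then a root of T^2 + B T + A C, so by normality v divides
   u A in R; setting v = 0 shows that v divides A, hence f, in k[x,y,z], which
   contradicts that R is a domain. So for each variable w some monomial w^n,
   w^n u or w^n v has degree h = a + b + c + alpha. The condition for z leaves
   c in {a+b+alpha, b+alpha} or c <= a+alpha, the one for y then makes b a
   linear function of a (or bounds b), and the one for x becomes divisibility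
   of a nonzero multiple of alpha by a, or an outright bound on a. *)
Require Import Defs.
From mathcomp Require Import all_boot all_order all_algebra.
From mathcomp Require Import generic_quotient ring_quotient fraction mxpoly.
From mathcomp Require Import zify ring.
From mathcomp Require boolp.
From mathcomp Require Import mpoly.

Import GRing.Theory.

Local Open Scope ring_scope.
Local Open Scope quotient_scope.

Lemma quotient_quadratic_relation (K : fieldType) (u v a b c : K) : v != 0 ->
  (u * a / v) ^+ 2 + b * (u * a) / v + a * c =
  a / v ^+ 2 * (u ^+ 2 * a + u * v * b + v ^+ 2 * c).
Proof. by move=> v0; field. Qed.

Lemma normal_divides (R : comNzRingType) (x y A B C : R) :
  normal_domain R -> y != 0 -> x ^+ 2 * A + x * y * B + y ^+ 2 * C = 0 ->
  exists r, x * A = r * y.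
Proof.
case=> domR closedR y0 eq0.
pose D := idomain_of domR; pose F := @tofrac D.
have Fy0 : F y != 0 by rewrite tofrac_eq0.
have [|r /(congr1 ( *%R^~ (F y)))] := closedR (F (x * A) / F y); last first.
  by rewrite divfK // -rmorphM => /eqP; rewrite tofrac_eq => /eqP; exists r.
(* Multiplying the relation by [A / y ^ 2] gives this monic equation for [x * A / y]. *)
exists ('X^2 + ((B : D)%:P * 'X + (A * C : D)%:P)).
  rewrite monicE lead_coefDl ?lead_coefXn // size_polyXn size_MXaddC.
  by case: ifP => // _; rewrite size_polyC; case: (_ != 0).
rewrite rootE rmorphD rmorphXn rmorphD rmorphM /= !map_polyX !map_polyC !hornerE /=.
have Fxy : F (x * A) = F x * F A by rewrite -rmorphM.
have FAC : F (A * C) = F A * F C by rewrite -rmorphM.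
have Feq : F x ^+ 2 * F A + F x * F y * F B + F y ^+ 2 * F C = 0.
  by rewrite -!(rmorphXn, rmorphM, rmorphD) /= eq0 rmorph0.
by rewrite -/F Fxy FAC quotient_quadratic_relation // Feq mulr0.
Qed.

(** The property passes to sums and products and holds for constants and variables. It turns
    vanishing under ['X_j := 0] into divisibility by ['X_j]. *)
Lemma mpoly_eq_subst0 n (K : comNzRingType) j (p : {mpoly K[n]}) :
   exists q, p = (p \mPo [tuple if i == j then 0 else 'X_i | i < n]) + q * 'X_j.
Proof.
set t := [tuple _ | _ < _]; pose P p := exists q, p = (p \mPo t) + q * 'X_j.
have PD p1 p2 : P p1 -> P p2 -> P (p1 + p2).
  by case=> q1 e1 [q2 e2]; exists (q1 + q2); rewrite {1}e1 {1}e2 rmorphD /=; ring.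
have PM p1 p2 : P p1 -> P p2 -> P (p1 * p2).
  case=> q1 e1 [q2 e2]; exists (q1 * p2 + (p1 \mPo t) * q2).
  rewrite rmorphM /=.
  by move: (p1 \mPo t) (p2 \mPo t) e1 e2 => s1 s2 -> ->; ring.
have PC c : P c%:MP by exists 0; rewrite comp_mpolyC mul0r addr0.
have PX i : P 'X_i.
  rewrite /P comp_mpolyXU -tnth_nth tnth_mktuple; case: eqP => [->|_].
    by exists 1; rewrite mul1r add0r.
  by exists 0; rewrite mul0r addr0.
rewrite -/(P p) (mpolyE p).
apply: (big_ind P _ PD) => [|m _]; first by rewrite -mpolyC0.
rewrite -mul_mpolyC mpolyXE_id; apply: (PM) => //.
apply: (big_ind P _ PM) => [|i _]; first by rewrite -mpolyC1.
by elim: (m i) => [|d IH]; rewrite ?expr0 ?exprS -?mpolyC1 //; apply: (PM).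
Qed.

Lemma mpoly_sum_multiple n (K : comNzRingType) (u : 'X_{1..n})
    (P : pred 'X_{1..n}) (p : {mpoly K[n]}) :
  {in msupp p, forall m, P m -> (u <= m)%MM} ->
  exists q, \sum_(m <- msupp p | P m) p@_m *: 'X_[m] = 'X_[u] * q.
Proof.
move=> uP; exists (\sum_(m <- msupp p | P m) p@_m *: 'X_[m - u]).
rewrite big_distrr /= big_seq_cond [RHS]big_seq_cond; apply: eq_bigr => m /andP[mp Pm].
by rewrite -scalerAr -mpolyXD addmC submK // uP.
Qed.

(** Sort the monomials by their exponent of ['X_j]: 0, 1 or at least 2. *)
Lemma mpoly_sq_idealP n (K : comNzRingType) (i j : 'I_n) (f : {mpoly K[n]}) : i != j ->
  {in msupp f, forall m : 'X_{1..n}, (1 < m i + m j)%N} ->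
  exists A B C, f = 'X_i ^+ 2 * A + 'X_i * 'X_j * B + 'X_j ^+ 2 * C.
Proof.
move=> ij fm.
have [A eA] : exists q,
    \sum_(m <- msupp f | m j == 0) f@_m *: 'X_[m] =
    'X_[U_(i) + U_(i)] * q.
  apply: mpoly_sum_multiple => m /fm; move=> m2 /eqP mj; apply/mnm_lepP => l.
  by rewrite mnmDE mnm1E; case: eqP => // <-; rewrite mj addn0 in m2.
(* [m j != 0] is kept to match the nested [bigID] splits below. *)
have [B eB] : exists q,
    \sum_(m <- msupp f | (m j != 0) && (m j == 1)) f@_m *: 'X_[m] =
    'X_[U_(i) + U_(j)] * q.
  apply: mpoly_sum_multiple => m /fm; move=> m2 /andP[_ /eqP mj]; apply/mnm_lepP => l.
  rewrite mj addn1 ltnS in m2; rewrite mnmDE !mnm1E.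
  by case: eqP => [<-|_]; [rewrite eq_sym (negPf ij)|case: eqP => // <-; rewrite mj].
have [C eC] : exists q,
    \sum_(m <- msupp f | (m j != 0) && (m j != 1)) f@_m *: 'X_[m] =
    'X_[U_(j) + U_(j)] * q.
  apply: mpoly_sum_multiple => m _ /andP[mj0 mj1]; apply/mnm_lepP => l.
  rewrite mnmDE mnm1E; case: eqP => // <-.
  by case: (m j) mj0 mj1 => [|[|d]].
exists A, B, C.
rewrite [LHS]mpolyE (bigID (fun m : 'X_{1..n} => m j == 0)) /=.
rewrite [X in _ + X](bigID (fun m : 'X_{1..n} => m j == 1)) /=.
by rewrite eA eB eC !mpolyXD addrA.
Qed.

(** Otherwise the hypersurface would be singular along ['X_i = 'X_j = 0], of codimension one in
    it. *)
Lemma normal_hypersurface_axis_monomial n (K : fieldType)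
    (I : idealr {mpoly K[n]}) (f : {mpoly K[n]}) (i j : 'I_n) :
  i != j -> f != 0 ->
  (forall p, p \in (I : {pred _}) <-> exists q, p = q * f) ->
  normal_domain {ideal_quot I} ->
  exists2 m : 'X_{1..n}, m \in msupp f & (m i + m j <= 1)%N.
Proof.
move=> ij f0 If nR; apply: boolp.contrapT => nex.
have [|A [B [C fE]]] := @mpoly_sq_idealP n K i j f ij.
  by move=> m mf; rewrite ltnNge; apply/negP => le1; apply: nex; exists m.
pose pi := \pi_({ideal_quot I}).
have piE p : pi p = 0 <-> exists q, p = q * f.
  rewrite -If -[p in p \in _]subr0 Quotient.idealrBE -(rmorph0 pi).
  by split=> [/eqP|/eqP].
have piB p q : pi (p - q) = pi p - pi q by apply: rmorphB.
have piM p q : pi (p * q) = pi p * pi q by apply: rmorphM.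
(* Value and ['X_j]-derivative at the origin: both vanish on multiples of [f], but [d0 'X_j = 1]. *)
pose e0 (p : {mpoly K[n]}) := p.@[fun=> 0].
pose d0 (p : {mpoly K[n]}) := e0 p^`M(j).
have e0D p q : e0 (p + q) = e0 p + e0 q by apply: rmorphD.
have e0M p q : e0 (p * q) = e0 p * e0 q by apply: rmorphM.
have e0X l : e0 'X_l = 0 by apply: mevalXU.
have d0D p q : d0 (p + q) = d0 p + d0 q by rewrite /d0 mderivD e0D.
have d0M p q : d0 (p * q) = d0 p * e0 q + e0 p * d0 q.
  by rewrite /d0 mderivM e0D !e0M.
have Xj0 : pi 'X_j != 0.
  apply/eqP => /piE[q qf].
  have : d0 'X_j = d0 (q * f) by rewrite qf.
  rewrite fE !(expr2, e0M, d0D, e0D, d0M, e0X) /d0 mderivX /e0 mnm1E eqxx scale1r.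
  rewrite -{1}[U_(j)%MM]addm0 addmC addmK mpolyX0 meval1 !(mul0r, mulr0, addr0).
  by move/eqP; rewrite oner_eq0.
have [domR _] := nR.
have [|r] :=
  @normal_divides _ (pi 'X_i) (pi 'X_j) (pi A) (pi B) (pi C) nR Xj0.
  by rewrite -!(rmorphM,rmorphD,rmorphXn) -fE; apply/piE;
    exists 1; rewrite mul1r.
rewrite -[r]reprK; move: (repr r) => {}r rE.
have /piE[s sE] : pi ('X_i * A - r * 'X_j) = 0 by rewrite piB !piM rE subrr.
have [A' AE] := mpoly_eq_subst0 n K j A; set t := [tuple _ | _ < _] in AE.
have tX l : 'X_l \mPo t = if l == j then 0 else 'X_l :> {mpoly K[n]}.
  by rewrite comp_mpolyXU -tnth_nth tnth_mktuple.
have tA : A \mPo t = 0.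
  have := congr1 (fun p => p \mPo t) sE.
  rewrite fE !(rmorphB, rmorphD, rmorphM, rmorphXn) /= !tX eqxx (negPf ij).
  move: (A \mPo t) (B \mPo t) (C \mPo t) (r \mPo t) (s \mPo t).
  move=> a b c r' s' eqa.
  (* At ['X_j = 0], [f] becomes ['X_i ^+ 2 * a]. The first two factors are nonzero: one is a
     variable, the other has value 1 at the origin. *)
  have /eqP : 'X_i * (1 - s' * 'X_i) * a = 0.
    transitivity ('X_i * a - r' * 0 -
                  s' * ('X_i ^+ 2 * a + 'X_i * 0 * b + 0 ^+ 2 * c)); first by ring.
    by rewrite eqa subrr.
  rewrite !mulf_eq0 => /orP[/orP[]|/eqP //] /eqP.
    by move/(congr1 (mcoeff U_(i))) => /eqP; rewrite mcoeffX mcoeff0 eqxx oner_eq0.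
  move/(congr1 e0); rewrite /e0 rmorphB rmorphM /= meval1 mevalXU mulr0 subr0 meval0.
  by move/eqP; rewrite oner_eq0.
have {AE tA} AE : A = A' * 'X_j by rewrite AE tA add0r.
have {fE AE} fE : f = ('X_i ^+ 2 * A' + 'X_i * B + 'X_j * C) * 'X_j.
  by rewrite fE AE; ring.
pose g := 'X_i ^+ 2 * A' + 'X_i * B + 'X_j * C; rewrite -/g in fE.
(* In the domain [pi g = 0], so [f] divides [g]; cancelling [g] makes ['X_j] a unit, absurd at the
   origin. *)
have : pi g * pi 'X_j = 0 by rewrite -piM -fE; apply/piE;
    exists 1; rewrite mul1r.
move/domR/orP => [/eqP/piE [q gE]|]; last by rewrite (negPf Xj0).
have g0 : g != 0 by apply: contraNneq f0 => g0; rewrite fE g0 mul0r.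
have /(congr1 e0) : 1 = q * 'X_j.
  by apply: (mulIf g0); rewrite mul1r {1}gE fE; ring.
by rewrite e0M e0X mulr0 /e0 meval1 => /eqP; rewrite oner_eq0.
Qed.

(** [x], [y], [z] are exponent vectors. The bounds are attained together by the pure powers of
    exponents 7, 3, 2 with [h = 42 * al]. *)
Lemma axis_degrees_bound (al a b c h : nat) (x y z : nat * nat * nat) :
  (0 < al -> 0 < a -> a <= b -> b <= c -> h = a + b + c + al ->
  x.1.2 + x.2 <= 1 -> x.1.1 * a + x.1.2 * b + x.2 * c = h ->
  y.1.1 + y.2 <= 1 -> y.1.1 * a + y.1.2 * b + y.2 * c = h ->
  z.1.1 + z.1.2 <= 1 -> z.1.1 * a + z.1.2 * b + z.2 * c = h ->
  [&& a <= 6 * al, b <= 14 * al & c <= 21 * al])%N.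
Proof.
case: x y z => [[n1 i1] j1] [[i2 n2] j2] [[i3 j3] n3] /= al0 a0 ab bc ->.
have small (i j : nat) : (i + j <= 1)%N ->
  [\/ i = 0%N /\ j = 0%N, i = 1%N /\ j = 0%N | i = 0%N /\ j = 1%N].
  by case: i j => [|[|i]] [|[|j]] // _; [apply: Or31|apply: Or33|apply: Or32].
move=> /small s1 e1 /small s2 e2 /small s3 e3.
(* Exponent [n3 <= 1] gives too small a degree, 2 gives [c] exactly, and [n3 >= 3] forces
   [2 * c <= a + b + al]. *)
have zE : (c = a + b + al \/ c = b + al \/ c <= a + al)%N.
  clear -al0 a0 ab bc s3 e3.
  case: s3 e3 => -[-> ->]; case: n3 => [|[|[|n3]]]; nia.
have yE : (c <= a + al \/
  [/\ b = 2 * a + 2 * al & c = a + b + al] \/ [/\ b = a + al & c = a + b + al] \/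
  [/\ b = a + 2 * al & c = a + b + al] \/ [/\ b = a + 2 * al & c = b + al] \/
  [/\ b = a + al & c = b + al] \/ b <= 2 * al)%N.
  clear -al0 a0 ab bc s2 e2 zE.
  case: zE => [->|[->|->]] in bc e2 *; last by left.
  - case: s2 e2 => -[-> ->]; case: n2 => [|[|[|[|[|n2]]]]]; nia.
  - case: s2 e2 => -[-> ->]; case: n2 => [|[|[|[|n2]]]]; nia.
(* The extremal family is [b = 2 * a + 2 * al], [c = 3 * a + 3 * al], where a pure power gives
   [(n1 - 6) * a = 6 * al]; hence the split at 7. *)
have aE : (a <= 6 * al)%N.
  clear -al0 a0 ab bc s1 e1 yE.
  case: yE => [|[|[|[|[|[|]]]]]]; [| case=> b' c'; subst b c..|]; try nia;
  case: s1 e1 => -[-> ->]; case: n1 => [|[|[|[|[|[|[|n1]]]]]]]; nia.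
lia.
Qed.

Theorem theorem2p1 (k : closedFieldType) (alpha : nat) (halpha : (0 < alpha)%N) :
  exists s : seq (nat * nat * nat * nat),
    forall a b c h : nat,
      (0 < a)%N -> (a <= b)%N -> (b <= c)%N -> h = (a + b + c + alpha)%N ->
      (exists (f : {mpoly k[3]}) (I : idealr {mpoly k[3]}),
         normal_graded_ring a b c h f I) ->
      (a, b, c, h) \in s.
Proof.
(* [h = a + b + c + alpha] is at most [(6 + 14 + 21 + 1) * alpha]. *)
pose S := iota 0 (42 * alpha).+1.
pose prod (T1 T2 : Type) (s1 : seq T1) (s2 : seq T2) :=
  [seq (x, y) | x <- s1, y <- s2].
exists (prod _ _ (prod _ _ (prod _ _ S S) S) S) => a b c h a0 ab bc hE [f [I]].
case=> _ f0 /dhomogP homf If _ nR _.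
pose i0 : 'I_3 := ord0; pose i1 : 'I_3 := lift ord0 ord0.
pose i2 : 'I_3 := lift ord0 (lift ord0 ord0).
have wE (m : 'X_{1..3}) : m \in msupp f -> (m i0 * a + m i1 * b + m i2 * c)%N = h.
  by move/homf => <-; rewrite /= /mwdeg !big_ord_recl big_ord0 addn0 addnA.
have axis (i j : 'I_3) ij := normal_hypersurface_axis_monomial 3 k I f i j ij f0 If nR.
have [x xf x1] := axis i1 i2 isT.
have [y yf y1] := axis i0 i2 isT.
have [z zf z1] := axis i0 i1 isT.
have /and3P[aS bS cS] := axis_degrees_bound alpha a b c h
  (x i0, x i1, x i2) (y i0, y i1, y i2) (z i0, z i1, z i2)
  halpha a0 ab bc hE x1 (wE _ xf) y1 (wE _ yf) z1 (wE _ zf).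
by do 3?[apply: allpairs_f]; rewrite mem_iota; lia.
Qed.
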